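(* Let $n=r$ be even and let $\Lambda=\mathbb T^tH_D\mathbb T$ (the quasi-commutation matrix in the Dipper–Donkin case). Then $\Lambda$ is invertible and the $r\times r$ blocks $\Lambda^{-1}_{\alpha\beta}$, $1\le\alpha,\beta\le n$, of its inverse are as follows. (a) $\Lambda^{-1}_{\alpha\alpha}=T^t-T$ for $\alpha\le n-1$. (b) $\Lambda^{-1}_{nn}=(P_n+\mathbb I)(\mathbb I-T)$, where $P_n=-X^{n-1}(\mathbb I-X)(X-X^n)^{-1}$. (c) $\Lambda^{-1}_{\alpha,\alpha-1}=\mathbb I-T^t$ for $2\le\alpha\le n-1$. (d) If $n>\alpha>\beta+1$, then $\Lambda^{-1}_{\alpha\beta}=-E_{rr}$ if $\alpha-\beta$ is even and $\Lambda^{-1}_{\alpha\beta}=E_{rr}$ if $\alpha-\beta$ is odd. (e) If $\beta<n-1$, then the only nonzero column of $\Lambda^{-1}_{n\beta}$ is the last one; its $i$-th entry is $0$ for $i=r-\beta$; if $\beta$ is even it is $(-1)^i$ for $i<r-\beta$ and $(-1)^{i+1}$ for $i>r-\beta$; if $\beta$ is odd it is $(-1)^{i+1}$ for $i<r-\beta$ and $(-1)^{i}$ for $i>r-\beta$. (f) $\Lambda^{-1}_{n,n-1}=(\mathbb I-T^t)+V$, where the only possibly nonzero column of the $r\times r$ matrix $V$ is the last one, equal to $(0,1,-1,1,-1,\dots,1,-1,0)^t$. (g) $\Lambda^{-1}_{\alpha\beta}=-(\Lambda^{-1}_{\beta\alpha})^t$ for $\alpha<\beta$.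
   Context: $E_{ij}$ are the $r\times r$ matrix units and $\mathbb I$ the identity. $N_r$ is the $r\times r$ matrix with all entries on and above the diagonal $-1$ and zeros below; $M_r=-N_r^t$; $X=N_r^{-1}M_r$; $T=\sum_{i=1}^{r-1}E_{i,i+1}$. $H_D$ is the $nr\times nr$ matrix of $n\times n$ blocks of size $r\times r$ with diagonal blocks $0$, blocks above the diagonal $M_r$ and blocks below the diagonal $N_r$ (invertible for $n=r$ even). $\mathbb T$ is the $nr\times nr$ block upper triangular matrix whose $(\alpha,\beta)$ block is $T^{\beta-\alpha}$ for $\alpha\le\beta$ (with $T^0=\mathbb I$) and $0$ for $\alpha>\beta$. *)

(* Defs.v *)
From HB Require Import structures.
From mathcomp Require Import all_boot all_order all_algebra.

Set Implicit Arguments.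
Unset Strict Implicit.
Unset Printing Implicit Defensive.

Import Order.TTheory GRing.Theory Num.Theory.
Local Open Scope ring_scope.

(* Ordinals count from 0, so the 1-based row, column or block index of
   a : 'I_m is a.+1.  The matrices of the paper have integer entries; they are
   read over a field F of characteristic 0, since X - X^n need not be
   invertible over the integers. *)

Section DipperDonkin.

Variable F : numFieldType.

(* The matrix unit E_{ij}; i and j are 1-based. *)
Definition E (r i j : nat) : 'M[F]_r :=
  \matrix_(k < r, l < r) ((k.+1 == i) && (l.+1 == j))%:R.

Definition T (r : nat) : 'M[F]_r := \sum_(1 <= i < r) E r i i.+1.

Definition N (r : nat) : 'M[F]_r :=
  \matrix_(i < r, j < r) (if (i <= j)%N then -1 else 0).

Definition M (r : nat) : 'M[F]_r := - (N r)^T.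

Definition X (r : nat) : 'M[F]_r := invmx (N r) *m M r.

Definition P (n r : nat) : 'M[F]_r :=
  - (X r ^+ n.-1 *m (1%:M - X r) *m invmx (X r - X r ^+ n)).

(* The (nr) x (nr) matrix with r x r blocks B a b; \sum_(i < n) r is the shape
   in which the library presents the size n * r of such a block matrix. *)
Definition blocks (n r : nat) (B : 'I_n -> 'I_n -> 'M[F]_r) :
    'M[F]_(\sum_(i < n) r) :=
  @mxblock F n n (fun=> r) (fun=> r) B.

Definition block (n r : nat) (A : 'M[F]_(\sum_(i < n) r)) (a b : 'I_n) :
    'M[F]_r :=
  @submxblock F n n (fun=> r) (fun=> r) A a b.

Definition HD (n r : nat) : 'M[F]_(\sum_(i < n) r) :=
  blocks (fun a b : 'I_n =>
    if (a < b)%N then M r else if (b < a)%N then N r else 0).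

Definition TT (n r : nat) : 'M[F]_(\sum_(i < n) r) :=
  blocks (fun a b : 'I_n => if (a <= b)%N then T r ^+ (b - a) else 0).

Definition Lambda (n r : nat) : 'M[F]_(\sum_(i < n) r) :=
  (TT n r)^T *m HD n r *m TT n r.

(* The matrix whose columns all vanish, except the last one, which is
   (f 1, ..., f r)^t. *)
Definition last_col (r : nat) (f : nat -> F) : 'M[F]_r :=
  \matrix_(i < r, j < r) (if j.+1 == r then f i.+1 else 0).

Definition last_col_e (r beta i : nat) : F :=
  if i == (r - beta)%N then 0
  else if ~~ odd beta then
    if (i < r - beta)%N then (-1) ^+ i else (-1) ^+ i.+1
  else
    if (i < r - beta)%N then (-1) ^+ i.+1 else (-1) ^+ i.

(* (0, 1, -1, 1, -1, ..., 1, -1, 0)^t *)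
Definition last_col_f (r i : nat) : F :=
  if (i == 1%N) || (i == r) then 0 else (-1) ^+ i.

End DipperDonkin.

(* Main.v *)
Require Import Defs.
From HB Require Import structures.
From mathcomp Require Import all_boot all_order all_algebra zify ring.

Set Implicit Arguments.
Unset Strict Implicit.
Unset Printing Implicit Defensive.

Import Order.TTheory GRing.Theory Num.Theory.
Local Open Scope ring_scope.

(** Since N^-1 = T - 1, X is the companion matrix of 1 + x + ... + x^r: it
    satisfies X^(r+1) = 1, and its powers act as a cyclic shift on the r + 1
    vectors e_0, ..., e_(r-1), -(e_0 + ... + e_(r-1)).  For n = r even this gives
    P = -(1 + X^2 + ... + X^(r-2)) = (X + X^2)^-1.  Up to the factor N, the
    matrix H_D is block Toeplitz with blocks X above and 1 below the diagonal;
    its inverse has blocks X^(b-a) P plus a correction on and above the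
    diagonal.  The inverse of TT has 1 on the diagonal and -T right above it, so
    each block of Lambda^-1 = TT^-1 H_D^-1 TT^-t involves four blocks of H_D^-1.
    They collapse because (1 - T) - X (1 - T) T^t = -X E_rr and
    1 - T X^-1 = E_rr have rank one. *)

(** * Sums of indicators *)

Lemma sum_delta (R : pzRingType) n a (f : nat -> R) :
  \sum_(c < n) (c == a :> nat)%:R * f c = if (a < n)%N then f a else 0.
Proof.
rewrite -(big_mkord xpredT (fun c => (c == a)%:R * f c)).
rewrite (eq_bigr (fun c => if c == a then f c else 0)).
  by rewrite -big_mkcond big_nat1_eq.
by move=> c _; case: eqP; rewrite (mul1r, mul0r).
Qed.

Lemma sum_pred1 (R : pzRingType) n a :
  (a < n)%N -> \sum_(c < n) (c == a :> nat)%:R = 1 :> R.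
Proof.
move=> a_lt; transitivity (\sum_(c < n) (c == a :> nat)%:R * 1 : R).
  by apply: eq_bigr => c _; rewrite mulr1.
by rewrite (sum_delta n a (fun=> 1)) a_lt.
Qed.

(** [m + k.*2] is injective in [k], so at most one term is nonzero. *)
Lemma sum_count_step2 (R : pzSemiRingType) h m t :
  \sum_(k < h) (m + k.*2 == t)%N%:R
    = ((m <= t < m + h.*2) && ~~ odd (t - m))%N%:R :> R.
Proof.
elim: h => [|h IHh]; first by rewrite big_ord0; case: andP => //; lia.
by rewrite big_ord_recr /= IHh -natrD; congr _%:R; lia.
Qed.

(* The parity conditions under which m + 2 k, for some k < r / 2, is r - 1 or r
   modulo r + 1. *)
Lemma column_windows r b i (m := (i + b.+2)%N) :
  (b <= r)%N -> (0 < r)%N -> ~~ odd r -> (i < r)%N ->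
  [/\ (m <= r.-1 < m + r)%N && ~~ odd (r.-1 - m)
        = (i.+1 < r - b)%N && (odd i (+) odd b),
      (m <= r.-1 + r.+1 < m + r)%N && ~~ odd (r.-1 + r.+1 - m)
        = (r - b < i.+1)%N && ~~ (odd i (+) odd b),
      (m <= r < m + r)%N && ~~ odd (r - m)
        = (i.+1 < r - b)%N && ~~ (odd i (+) odd b)
    & (m <= r + r.+1 < m + r)%N && ~~ odd (r + r.+1 - m)
        = (r - b < i.+1)%N && (odd i (+) odd b)].
Proof. by rewrite /m => *; split; lia. Qed.

(** * Ring elements with 1 + x + ... + x^r = 0, and the inverse of their Toeplitz matrix *)

Section GeometricSum.

Variables (R : pzRingType) (x : R) (r : nat).
Hypothesis geom0 : \sum_(k < r.+1) x ^+ k = 0.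

Lemma geom0_expr : x ^+ r.+1 = 1.
Proof. by apply/eqP; rewrite -subr_eq0 subrX1 geom0 mulr0. Qed.

(** Summation by parts. This inverts x - 1 wherever r + 1 is invertible. *)
Lemma geom0_sub1 : (x - 1) * (\sum_(k < r.+1) x ^+ k *+ k) = r.+1%:R.
Proof.
have sumE m : (x - 1) * (\sum_(k < m) x ^+ k *+ k)
            = x ^+ m *+ m - x * \sum_(k < m) x ^+ k.
  elim: m => [|m IHm]; first by rewrite !big_ord0 !mulr0 subr0.
  rewrite !big_ord_recr /= mulrDr IHm mulrnAr mulrBl mul1r mulrnBl mulrDr -exprS.
  by rewrite opprD mulrSr [RHS]addrACA subrr addr0 [LHS]addrC addrA subrK.
by rewrite sumE geom0 mulr0 subr0 geom0_expr.
Qed.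

Hypothesis r_even : ~~ odd r.

Local Notation p := (- \sum_(k < r./2) x ^+ k.*2).

(** Multiplying the even powers by 1 + x fills in the odd ones, giving the sum of all x^k with k <
    r, which is -x^r; a further factor x gives -x^(r+1) = -1. *)
Lemma geom0_evenK : (x + x ^+ 2) * p = 1.
Proof.
have sumE h : (1 + x) * (\sum_(k < h) x ^+ k.*2) = \sum_(k < h.*2) x ^+ k.
  elim: h => [|h IHh]; first by rewrite !big_ord0 mulr0.
  by rewrite doubleS !big_ord_recr /= mulrDr IHh mulrDl mul1r -exprS addrA.
rewrite -[X in (X + _) * _]mulr1 expr2 -mulrDr mulrN -mulrA sumE even_halfK //.
move/eqP: geom0; rewrite big_ord_recr /= addr_eq0 => /eqP ->.
by rewrite mulrN opprK -exprS geom0_expr.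
Qed.

Lemma geom0_even_comm : GRing.comm x p.
Proof. by apply: commrN; apply: commr_sum => k _; apply: commrX. Qed.

Lemma geom0_expr_mod k l : k = l %[mod r.+1] -> x ^+ k = x ^+ l.
Proof.
by move=> kl; rewrite -(expr_mod k geom0_expr) kl expr_mod ?geom0_expr.
Qed.

Hypothesis r_gt0 : (0 < r)%N.

Lemma geom0_subX : x - x ^+ r = (x + x ^+ 2) * x ^+ r.-1 * (x - 1).
Proof.
rewrite mulrDl -exprS -exprD add2n prednK // geom0_expr.
rewrite mulrBr mulr1 mulrDl mul1r -exprSr geom0_expr.
by rewrite [x ^+ r + 1]addrC opprD addrACA subrr add0r.
Qed.

(** As r = -1 modulo r + 1, the exponents r c with c <= r run through all residues, so the full sum
    is 0; the missing terms c = r - 1 and c = r are x^2 and x. *)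
Lemma geom0_sum_inv : \sum_(c < r.-1) x ^+ (r * c) = - (x + x ^+ 2).
Proof.
have : \sum_(c < r.+1) x ^+ (r * c) = 0.
  transitivity (x * \sum_(c < r.+1) x ^+ c); last by rewrite geom0 mulr0.
  rewrite mulr_sumr [RHS](reindex_inj rev_ord_inj) /=.
  apply: eq_bigr => c _; rewrite -exprS /=; apply: geom0_expr_mod.
  have hc := ltn_ord c; rewrite -[LHS]modnDr -[RHS](modnMDl c).
  by congr (_ %% _)%N; nia.
have rr : x ^+ (r * r) = x.
  rewrite -[RHS]expr1; apply: geom0_expr_mod.
  by rewrite -[RHS](modnMDl r.-1); congr (_ %% _)%N; nia.
have rr1 : x ^+ (r * r.-1) = x ^+ 2.
  apply: geom0_expr_mod; rewrite -[LHS]modnDr -[RHS](modnMDl r.-1).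
  by congr (_ %% _)%N; nia.
move: rr rr1; case: (r) r_gt0 => // r' _ /= rr rr1; rewrite 2!big_ord_recr /=.
by rewrite rr rr1 -addrA [x ^+ 2 + x]addrC => /eqP; rewrite addr_eq0 => /eqP.
Qed.

(* As x^r = x^-1, the powers x^(b + r a) and x^(b + r (a + 1)) below stand for
   x^(b - a) and x^(b - a - 1). *)
Definition cyc_corr a b : R :=
  if a == b then 1 else if (a < b)%N then x ^+ (b + r * a) - x ^+ (b + r * a.+1)
  else 0.

Definition cyc_inv a b : R := x ^+ (b + r * a) * p + cyc_corr a b.

Definition cyc_mx (a b : nat) : R :=
  if (a < b)%N then x else if (b < a)%N then 1 else 0.

Lemma geom0_expr_diag a : x ^+ (a + r * a) = 1.
Proof. by rewrite -mulSn exprM geom0_expr expr1n. Qed.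

(** The terms with c < b telescope, and the diagonal 1 = x^(b + r b) removes the remaining tail. *)
Lemma sum_cyc_corr m b :
  \sum_(c < m) cyc_corr c b
    = x ^+ b - (if (m <= b)%N then x ^+ (b + r * m) else 0).
Proof.
elim: m => [|m IHm]; first by rewrite big_ord0 muln0 addn0 subrr.
rewrite big_ord_recr /= IHm /cyc_corr.
case: ltngtP => [mb|bm|->]; rewrite ?subr0 ?addr0 //.
  by rewrite addrA subrK.
by rewrite geom0_expr_diag subrK.
Qed.

(** Since x^(r+1) = 1, the factor x undoes the extra r in the exponent. The parts with p cancel, and
    the corrections leave something only at b = a and b = a + 1. *)
Lemma cyc_inv_step a b :
  cyc_inv a b - x * cyc_inv a.+1 b = (a == b)%:R - (a.+1 == b)%:R.
Proof.
rewrite /cyc_inv mulrDr opprD addrACA mulrA -exprS.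
rewrite (@geom0_expr_mod (b + r * a.+1).+1 (b + r * a)); last first.
  by rewrite -[RHS]modnDr; congr (_ %% _)%N; nia.
rewrite subrr add0r /cyc_corr.
case: (ltngtP a b) => [ab|ba|->].
- case: (ltngtP a.+1 b) => [ab1|ba|<-]; last first.
  - rewrite geom0_expr_diag (@geom0_expr_mod _ 1) ?expr1 ?mulr1 1?addrAC ?subrr //.
    by rewrite -[RHS](modnMDl a); congr (_ %% _)%N; nia.
  - lia.
  rewrite mulrBr -!exprS.
  rewrite (@geom0_expr_mod (b + r * a.+1).+1 (b + r * a)); last first.
    by rewrite -[RHS]modnDr; congr (_ %% _)%N; nia.
  rewrite (@geom0_expr_mod (b + r * a.+2).+1 (b + r * a.+1)); last first.
    by rewrite -[RHS]modnDr; congr (_ %% _)%N; nia.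
  by rewrite !subrr.
- have -> : (a.+1 == b) = false by lia.
  have -> : (a.+1 < b)%N = false by lia.
  by rewrite mulr0.
have -> : (b.+1 == b) = false by lia.
by rewrite ltnNge leqnSn mulr0.
Qed.

(* The differences of consecutive rows are given by cyc_inv_step; only the last
   row needs the value of a geometric sum. *)
Lemma cyc_mx_inv a b : (a < r)%N -> (b < r)%N ->
  \sum_(c < r) cyc_mx a c * cyc_inv c b = - (a == b)%:R.
Proof.
move=> a_lt b_lt.
have [m] : exists m, (a + m)%N = r.-1 by exists (r.-1 - a)%N; lia.
elim: m a a_lt => [|m IHm] a a_lt am.
  have {am} -> : a = r.-1 by lia.
  transitivity (\sum_(c < r.-1) cyc_inv c b).
    case: (r) r_gt0 => // q _; rewrite big_ord_recr /= {2}/cyc_mx ltnn mul0r addr0.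
    apply: eq_bigr => c _.
    by rewrite /cyc_mx ltn_ord ltnNge ltnW ?ltn_ord // mul1r.
  rewrite big_split /= sum_cyc_corr -mulr_suml.
  rewrite (eq_bigr (fun c : 'I_r.-1 => x ^+ b * x ^+ (r * c))); last first.
    by move=> c _; rewrite exprD.
  (* The geometric part sums to -x^b and cancels the x^b from [sum_cyc_corr]. *)
  rewrite -mulr_sumr geom0_sum_inv -mulrA mulNr geom0_evenK mulrN1 addKr.
  congr (- _); case: leqP => [rb|]; case: eqP => //; [|lia|lia].
  by move <-; rewrite geom0_expr_diag.
have a1_lt : (a.+1 < r)%N by lia.
rewrite -[LHS]opprK; congr (- _); apply/eqP.
rewrite -(inj_eq (addrI (- (a.+1 == b)%:R))) -(IHm a.+1) ?addSnnS // -sumrB.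
rewrite {1}IHm ?addSnnS // addrC -cyc_inv_step.
(* Row a + 1 minus row a of [cyc_mx] is 1 in column a, -x in column a + 1, and 0 elsewhere. *)
rewrite (eq_bigr (fun c : 'I_r => (c == a :> nat)%:R * cyc_inv c b
   - (c == a.+1 :> nat)%:R * (x * cyc_inv c b))).
  rewrite sumrB (sum_delta r a (cyc_inv^~ b)).
  by rewrite (sum_delta r a.+1 (fun c => x * cyc_inv c b)) a_lt a1_lt.
move=> c _; rewrite mulrA -!mulrBl; congr (_ * _); rewrite /cyc_mx.
have aSa : (a.+1 < a)%N = false by lia.
have a_aS : (a == a.+1) = false by lia.
by case: (ltngtP a c) => [|?|<-]; case: (ltngtP a.+1 c) => //; try lia; move=> *;
   rewrite ?aSa ?ltnSn ?a_aS ?mul0r ?mul1r ?subrr ?subr0 ?sub0r.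
Qed.

End GeometricSum.

(** * Arithmetic of block matrices *)

Section Blocks.

Variables (F : numFieldType) (n r : nat).
Implicit Types (B C : 'I_n -> 'I_n -> 'M[F]_r) (A : 'M[F]_(\sum_(i < n) r)).

Lemma blockK B a b : block (blocks B) a b = B a b.
Proof. exact: mxblockK. Qed.

Lemma mul_blocks B C :
  blocks B *m blocks C = blocks (fun a b => \sum_c B a c * C c b).
Proof. exact: mul_mxblock. Qed.

Lemma tr_blocks B : (blocks B)^T = blocks (fun a b => (B b a)^T).
Proof. exact: tr_mxblock. Qed.

Lemma tr_block A a b : block A^T a b = (block A b a)^T.
Proof. exact/esym/tr_submxblock. Qed.

Lemma blockN A a b : block (- A) a b = - block A a b.
Proof. by apply/matrixP => i j; rewrite !mxE. Qed.

Lemma eq_blocks B C : (forall a b, B a b = C a b) -> blocks B = blocks C.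
Proof. by move=> BC; apply: eq_mxblock => a b; apply: BC. Qed.

Lemma blocks1 :
  blocks (fun a b : 'I_n => (a == b :> nat)%:R) = 1%:M :> 'M[F]_(\sum_(i < n) r).
Proof.
rewrite -mxdiagZ; apply: eq_mxblock => a b.
by rewrite -val_eqE; case: eqP; rewrite ?conform_mx_id.
Qed.

End Blocks.

(** * Entries of T, N, X and of the powers of X *)

Section Entries.

Variables (F : numFieldType) (r : nat).
Local Notation T := (T F r).
Local Notation N := (N F r).
Local Notation X := (X F r).
Local Notation Err := (E F r r r).

Lemma TE : T = \matrix_(i, j) (j == i.+1 :> nat)%:R.
Proof.
apply/matrixP => k l; rewrite /Defs.T summxE mxE.
under eq_bigr => i _.
  rewrite mxE eqSS eq_sym -mulnb natrM.
  have -> : (i == k.+1)%:R * (l == i :> nat)%:R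
            = if i == k.+1 then (l == k.+1 :> nat)%:R else 0 :> F.
    by case: eqP => [->|]; rewrite (mul1r, mul0r).
  over.
rewrite -big_mkcond big_nat1_eq /=; case: ifP => // /negbT.
by case: eqP => //; have := ltn_ord l; lia.
Qed.

Lemma mulT_mx m (f : nat -> nat -> F) :
  T *m \matrix_(i < r, j < m) f i j
    = \matrix_(i, j) if (i.+1 < r)%N then f i.+1 j else 0.
Proof.
apply/matrixP => i j; rewrite TE !mxE -(sum_delta r i.+1 (fun k => f k j)).
by apply: eq_bigr => k _; rewrite !mxE.
Qed.

(** T shifts the rows of N up by one, and consecutive rows of N differ by a unit vector. *)
Lemma invmx_N : N \in unitmx /\ invmx N = T - 1.
Proof.
have TN : (T - 1) * N = 1.
  rewrite mulrBl mul1r {1}/Defs.N -mulmxE.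
  rewrite (mulT_mx _ (fun i j => if (i <= j)%N then -1 else 0)).
  apply/matrixP => i j; rewrite !mxE -val_eqE /=.
  have := ltn_ord j; have := ltn_ord i.
  by case: (ltnP i.+1 r); case: (ltngtP i j) => //=;
     rewrite ?subr0 ?subrr ?sub0r ?opprK //; lia.
have [_ uN] := mulmx1_unit TN; split=> //.
by apply: (can_inj (mulmxK uN)); rewrite mulVmx.
Qed.

Lemma XE : X = \matrix_(i, j) ((j == i.+1 :> nat)%:R - (i.+1 == r)%:R).
Proof.
rewrite /Defs.X (proj2 invmx_N) /M mulmxN -mulNmx opprB mulmxBl mul1mx.
have -> : N^T = \matrix_(i, j < r) if (j <= i)%N then -1 else 0.
  by apply/matrixP => i j; rewrite !mxE.
rewrite (mulT_mx _ (fun i j => if (j <= i)%N then -1 else 0)).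
apply/matrixP => i j; rewrite !mxE.
have := ltn_ord j; have := ltn_ord i.
by case: (ltngtP i.+1 r); case: (ltngtP j i.+1); case: (leqP j i) => //=;
   rewrite ?subr0 ?subrr ?sub0r ?opprK ?addNr //; lia.
Qed.

Lemma mulNX : N * X = M F r.
Proof. by rewrite /Defs.X mulrA -mulmxE mulmxV ?mul1mx; case: invmx_N. Qed.

(** With 1 - T = -N^-1 and M = -N^t, the factors N^t and N^-t cancel and N^-1 remains. *)
Lemma mulX_tr1T : X * (1 - T)^T = T - 1.
Proof.
have [uN NV] := invmx_N.
have -> : 1 - T = - invmx N by rewrite NV opprB.
rewrite -[RHS]NV /Defs.X /M mulmxN -mulmxE [(- invmx N)^T]linearN /=.
by rewrite mulmxN mulNmx opprK -mulmxA -trmx_mul mulVmx // trmx1 mulmx1.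
Qed.

Lemma mulT_trT : T * T^T = 1 - Err.
Proof.
have -> : T^T = \matrix_(i, j < r) (i == j.+1 :> nat)%:R.
  by apply/matrixP => i j; rewrite TE !mxE.
rewrite -mulmxE (mulT_mx _ (fun i j => (i == j.+1)%:R)).
apply/matrixP => i j; rewrite !mxE -val_eqE /=.
rewrite eqSS; case: (ltngtP i.+1 r) (ltn_ord i) => // [_|ir] _.
  by rewrite subr0.
have -> : (j.+1 == r) = (i == j :> nat) by lia.
by rewrite subrr.
Qed.

(** X and T differ only in the last row, where T vanishes. *)
Lemma mulErr_X : Err * X = X - T.
Proof.
apply/matrixP => i j; rewrite TE XE !mxE.
rewrite (eq_bigr (fun k : 'I_r => (k == r.-1 :> nat)%:R *
    ((i.+1 == r)%:R * ((j == k.+1 :> nat)%:R - (k.+1 == r)%:R)))); last first.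
  move=> k _; rewrite !mxE -mulnb natrM mulrA -!natrM; congr (_%:R * _).
  by have := ltn_ord k; lia.
rewrite (sum_delta r _ (fun k =>
    (i.+1 == r)%:R * ((j == k.+1 :> nat)%:R - (k.+1 == r)%:R))).
have := ltn_ord j; have := ltn_ord i => hi hj.
rewrite prednK; last by lia.
by rewrite eqxx leqnn (ltn_eqF hj) sub0r mulrN1 [in RHS]addrC addKr.
Qed.

(* Row i of X^k is e_(i + k), with the index read modulo r + 1 and
   e_r := -(e_0 + ... + e_(r-1)). *)
Lemma exprXE k : X ^+ k = \matrix_(i < r, j < r)
  (((i + k) %% r.+1 == j)%N%:R - ((i + k) %% r.+1 == r)%N%:R).
Proof.
elim: k => [|k IHk].
  apply/matrixP => i j.
  rewrite !mxE addn0 modn_small ?ltnS ?(ltnW (ltn_ord i)) //.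
  by rewrite (ltn_eqF (ltn_ord i)) subr0 -val_eqE.
rewrite exprSr IHk XE; apply/matrixP => i j; rewrite !mxE.
set t := ((i + k) %% r.+1)%N.
have t_le : (t <= r)%N by rewrite -ltnS ltn_mod.
rewrite addnS -[(i + k).+1]addn1 -modnDml -/t.
pose f l : F := (j == l.+1 :> nat)%:R - (l.+1 == r)%:R.
rewrite (eq_bigr (fun l : 'I_r =>
    (l == t :> nat)%:R * f l - (t == r)%:R * f l)).
  rewrite sumrB -mulr_sumr (sum_delta _ _ f) sumrB.
  have j_lt := ltn_ord j.
  have -> : \sum_(l < r) (l.+1 == r)%:R = 1 :> F.
    apply: etrans (@sum_pred1 _ r r.-1 _); last by lia.
    by apply: eq_bigr => l _; congr _%:R; lia.
  have -> : \sum_(l < r) (j == l.+1 :> nat)%:R = (0 < j)%:R :> F.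
    case: (posnP j) => [->|j_gt0]; first by rewrite big1.
    apply: etrans (@sum_pred1 _ r j.-1 _); last by lia.
    by apply: eq_bigr => l _; congr _%:R; lia.
  case: ltngtP t_le => // [t_lt|->] _; rewrite addn1.
    by rewrite mul0r subr0 modn_small ?ltnS // /f eq_sym.
  rewrite modnn mul1r sub0r opprB (@ltn_eqF 0 r) ?(leq_ltn_trans _ j_lt) //.
  rewrite subr0.
  by case: posnP => [->|/ltn_eqF ->]; rewrite ?subr0 // subrr.
by move=> l _; rewrite !mxE -mulrBl eq_sym.
Qed.

(** For fixed i, the index i + k meets every residue modulo r + 1 exactly once, so both indicators
    in [exprXE] sum to 1. *)
Lemma sum_exprX : \sum_(k < r.+1) X ^+ k = 0.
Proof.
apply/matrixP => i j; rewrite summxE mxE.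
have shift t : (t <= r)%N ->
    \sum_(k < r.+1) ((i + k) %% r.+1 == t)%N%:R = 1 :> F.
  move=> t_le; pose u := (if i <= t then t - i else t + r.+1 - i)%N.
  have hi := ltn_ord i; apply: etrans (@sum_pred1 _ r.+1 u _); last first.
    by rewrite /u; case: ifP; lia.
  apply: eq_bigr => k _; congr _%:R; have hk := ltn_ord k.
  have [ik|ik] := ltnP (i + k) r.+1.
    by rewrite modn_small /u //; case: leqP; lia.
  by rewrite -(subnK ik) modnDr modn_small /u; [case: leqP|]; lia.
under eq_bigr do rewrite exprXE mxE.
by rewrite sumrB !shift ?subrr // ltnW.
Qed.

Lemma mulmx_Err (f : nat -> nat -> F) : (0 < r)%N ->
  \matrix_(i, j < r) f i j * Err = last_col r (fun i => f i.-1 r.-1).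
Proof.
move=> r_gt0; apply/matrixP => i j; rewrite !mxE /=.
rewrite (eq_bigr (fun l : 'I_r =>
    (l == r.-1 :> nat)%:R * ((j.+1 == r)%:R * f i l))).
  rewrite (sum_delta r _ (fun l => (j.+1 == r)%:R * f i l)) ltn_predL r_gt0.
  by case: eqP; rewrite ?mul1r ?mul0r.
move=> l _; rewrite !mxE mulrC -mulnb natrM -mulrA; congr (_%:R * _).
by have := ltn_ord l; lia.
Qed.

Lemma mulErr_last_col (f : nat -> F) : (0 < r)%N ->
  Err * last_col r f = f r *: Err.
Proof.
move=> r_gt0; apply/matrixP => i j; rewrite !mxE /=.
rewrite (eq_bigr (fun l : 'I_r => (l == r.-1 :> nat)%:R *
   ((i.+1 == r)%:R * (if j.+1 == r then f l.+1 else 0)))).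
  rewrite (sum_delta r _ (fun l =>
      (i.+1 == r)%:R * (if j.+1 == r then f l.+1 else 0))).
  rewrite ltn_predL r_gt0 prednK //.
  by case: eqP => _; case: eqP => _; rewrite ?mul1r ?mul0r ?mulr0 ?mulr1.
move=> l _; rewrite !mxE -mulnb natrM -!mulrA mulrCA; congr (_%:R * _).
by have := ltn_ord l; lia.
Qed.

Lemma mulXBT_Err : (0 < r)%N -> (X - T) * Err = - Err.
Proof.
move=> r_gt0.
have -> : X - T = \matrix_(i, j) - (i.+1 == r)%:R.
  by apply/matrixP => i j; rewrite XE TE !mxE addrC addKr.
rewrite (mulmx_Err (fun i j => - (i.+1 == r)%:R)) //.
apply/matrixP => i j; rewrite !mxE /=.
by case: eqP; case: eqP; rewrite ?oppr0.
Qed.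

(** Each factor in [geom0_subX] is invertible; for X - 1, [geom0_sub1] is divided by r + 1, which
    uses characteristic 0. Both sides of the formula for P agree after multiplication by X - X^r. *)
Lemma PE : (0 < r)%N -> ~~ odd r ->
  X - X ^+ r \in unitmx /\ P F r r = - \sum_(k < r./2) X ^+ k.*2.
Proof.
move=> r_gt0 r_even; have geom0 := sum_exprX.
have subX := geom0_subX geom0 r_gt0.
have evenK := geom0_evenK geom0 r_even.
have unitW : X - X ^+ r \in unitmx.
  rewrite subX -!mulmxE !unitmx_mul (proj1 (mulmx1_unit evenK)) /=.
  apply/andP; split.
    apply: (proj1 (mulmx1_unit (B := X ^+ 2) _)).
    by rewrite mulmxE -exprD addn2 prednK // (geom0_expr geom0).
  apply: (proj1 (mulmx1_unit
    (B := r.+1%:R^-1 *: \sum_(k < r.+1) X ^+ k *+ k) _)).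
  rewrite -scalemxAr mulmxE (geom0_sub1 geom0).
  rewrite -[X in _ *: X](scaler_nat r.+1 (1 : 'M[F]_r)) scalerA.
  by rewrite mulVf ?scale1r // pnatr_eq0.
split=> //; rewrite /P -mulNmx.
apply: (can_inj (mulmxK unitW)); rewrite mulmxKV // subX -!mulmxE.
rewrite !mulmxA !mulmxE -mulrN opprB.
(* [geom0_evenK] has the even sum on the right of X + X^2, whereas here it stands on the left. *)
have comm_P := commr_sym (geom0_even_comm X r).
by rewrite (commrD comm_P (commrX 2 comm_P)) evenK mul1r.
Qed.

(** By [exprXE], entry i counts the k for which i + b + 2 + 2k is r - 1 modulo r + 1, minus those
    for which it is r. These counts produce the alternating signs. *)
Lemma exprX_P_last_col b : (b <= r)%N -> (0 < r)%N -> ~~ odd r ->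
  - (X ^+ b.+2 * P F r r) * Err = last_col r (last_col_e F r b).
Proof.
move=> b_le r_gt0 r_even; rewrite (proj2 (PE r_gt0 r_even)) mulrN opprK.
pose f i j : F := \sum_(k < r./2)
  (((i + (b.+2 + k.*2)) %% r.+1 == j)%N%:R
   - ((i + (b.+2 + k.*2)) %% r.+1 == r)%N%:R).
have -> : X ^+ b.+2 * \sum_(k < r./2) X ^+ k.*2 = \matrix_(i, j) f i j.
  apply/matrixP => i j; rewrite mulr_sumr summxE mxE; apply: eq_bigr => k _.
  by rewrite -exprD exprXE mxE.
rewrite mulmx_Err //; apply/matrixP => i j; rewrite !mxE; case: eqP => // _.
rewrite {}/f /= /last_col_e; set m := (i + b.+2)%N.
have hi := ltn_ord i.
(* As m + 2k <= 3r - 1, reduction modulo r + 1 to t leaves only the values t and t + r + 1. *)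
have mod_eq k t : (k < r./2)%N -> (r.-1 <= t <= r)%N ->
    ((i + (b.+2 + k.*2)) %% r.+1 == t)%N%:R
      = (m + k.*2 == t)%N%:R + (m + k.*2 == t + r.+1)%N%:R :> F.
  move=> k_lt t_le; rewrite -natrD; congr _%:R; rewrite addnA -/m.
  have [s_lt|s_ge] := ltnP (m + k.*2) r.+1; first by rewrite modn_small //; lia.
  rewrite -{1}(subnK s_ge) modnDr.
  have [s_lt2|s_ge2] := ltnP (m + k.*2 - r.+1) r.+1.
    by rewrite modn_small //; lia.
  by rewrite -(subnK s_ge2) modnDr modn_small; lia.
rewrite (eq_bigr (fun k : 'I_r./2 =>
  (m + k.*2 == r.-1)%N%:R + (m + k.*2 == r.-1 + r.+1)%N%:R
  - ((m + k.*2 == r)%N%:R + (m + k.*2 == r + r.+1)%N%:R) : F)); last first.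
  by move=> k _; rewrite !mod_eq //; lia.
rewrite sumrB !big_split /= !sum_count_step2 even_halfK //.
rewrite -[(-1) ^+ i.+2]signr_odd -[(-1) ^+ i.+1]signr_odd /=.
have [-> -> -> ->] := column_windows b_le r_gt0 r_even hi.
by case: (ltngtP i.+1 (r - b)%N) => _; case: (odd i); case: (odd b);
   rewrite /= ?addr0 ?add0r ?subr0 ?sub0r ?expr0 ?expr1 ?oppr0 ?addr0 ?oppr0.
Qed.

End Entries.

(** * The bidiagonal inverse of [TT] *)

Section Bidiagonal.

Variables (F : numFieldType) (n r : nat).
Local Notation T := (T F r).

Definition bidiag : 'M[F]_(\sum_(i < n) r) :=
  blocks (fun a b : 'I_n => (b == a :> nat)%:R - T * (b == a.+1 :> nat)%:R).

(** Indexing B by naturals gives [B a.+1 b] a meaning in the last block row, where the test replaces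
    it by 0. *)
Lemma mul_bidiag (B : nat -> nat -> 'M[F]_r) :
  bidiag *m blocks (fun a b : 'I_n => B a b)
    = blocks (fun a b : 'I_n =>
        B a b - T * (if (a.+1 < n)%N then B a.+1 b else 0)).
Proof.
rewrite mul_blocks; apply: eq_blocks => a b.
under eq_bigr do rewrite mulrBl -mulrA.
rewrite sumrB -mulr_sumr (sum_delta n a (B^~ b)) (sum_delta n a.+1 (B^~ b)).
by rewrite ltn_ord.
Qed.

Lemma mul_bidiag_tr (B : nat -> nat -> 'M[F]_r) :
  blocks (fun a b : 'I_n => B a b) *m bidiag^T
    = blocks (fun a b : 'I_n =>
        B a b - (if (b.+1 < n)%N then B a b.+1 else 0) * T^T).
Proof.
apply: trmx_inj; rewrite trmx_mul trmxK !tr_blocks.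
rewrite (mul_bidiag (fun a b => (B b a)^T)); apply: eq_blocks => a b.
rewrite [RHS]linearB /= -mulmxE trmx_mul trmxK; congr (_ - _ *m _).
by case: ifP; rewrite ?trmx0.
Qed.

Lemma bidiagK : bidiag *m TT F n r = 1%:M.
Proof.
rewrite /TT (mul_bidiag (fun a b => if (a <= b)%N then T ^+ (b - a) else 0)).
rewrite -blocks1; apply: eq_blocks => a b; have hb := ltn_ord b.
case: (ltngtP a b) => [ab|ba|ab]; last 1 first.
- by rewrite ab subnn expr0; case: ifP; rewrite mulr0 subr0.
- by rewrite (leq_ltn_trans ab hb) -exprS -subSn // subSS subrr.
by case: ifP; rewrite mulr0 subr0.
Qed.

End Bidiagonal.

(** This skew-symmetry passes to Lambda and its inverse, and yields the blocks above the
    diagonal. *)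
Lemma HD_tr (F : numFieldType) n r : (HD F n r)^T = - HD F n r.
Proof.
rewrite /HD tr_blocks -[in RHS]/(mxblock _) -mxblockN; apply: eq_blocks => a b.
by rewrite /M; case: ltngtP; rewrite ?trmx0 ?oppr0 ?opprK // linearN /= trmxK.
Qed.

(** * The inverses of [HD] and [Lambda], block by block *)

Section Inverse.

Variables (F : numFieldType) (r : nat).
Hypotheses (r_gt0 : (0 < r)%N) (r_even : ~~ odd r).
Local Notation T := (T F r).
Local Notation N := (N F r).
Local Notation X := (X F r).
Local Notation Err := (E F r r r).
Local Notation P := (P F r r).
Let geom0 := @sum_exprX F r.

(** [HD] has blocks N times [cyc_mx X], which [cyc_inv] inverts up to sign; the sign turns 1 - T
    into T - 1 = N^-1. *)
Definition HD_inv a b : 'M[F]_r := cyc_inv X r a b * (1 - T).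

Lemma HD_invP : HD F r r *m blocks (fun a b : 'I_r => HD_inv a b) = 1%:M.
Proof.
rewrite mul_blocks -blocks1; apply: eq_blocks => a b.
rewrite (eq_bigr (fun c : 'I_r =>
   N * (cyc_mx X a c * cyc_inv X r c b) * (1 - T))); last first.
  move=> c _; rewrite /HD_inv /cyc_mx !mulrA; congr (_ * _ * _).
  by case: ltngtP => _; rewrite ?mulNX ?mulr1 ?mulr0.
rewrite -mulr_suml -mulr_sumr cyc_mx_inv // mulrN mulNr -mulrN opprB.
have [uN <-] := invmx_N F r; case: eqP; rewrite ?mulr0 ?mul0r // mulr1.
by rewrite -mulmxE mulmxV.
Qed.

Definition Lambda_inv : 'M[F]_(\sum_(i < r) r) :=
  bidiag F r r *m blocks (fun a b : 'I_r => HD_inv a b) *m (bidiag F r r)^T.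

Lemma Lambda_invP :
  Lambda F r r \in unitmx /\ invmx (Lambda F r r) = Lambda_inv.
Proof.
have LV : Lambda F r r *m Lambda_inv = 1%:M.
  rewrite /Lambda_inv /Lambda -!mulmxA [TT F r r *m _]mulmxA.
  rewrite (mulmx1C (bidiagK F r r)) mul1mx [HD F r r *m _]mulmxA HD_invP mul1mx.
  by rewrite -trmx_mul bidiagK trmx1.
have [uL _] := mulmx1_unit LV; split=> //.
by apply: (can_inj (mulKmx uL)); rewrite mulmxV.
Qed.

Lemma Lambda_inv_tr : Lambda_inv^T = - Lambda_inv.
Proof.
have [uL <-] := Lambda_invP; rewrite trmx_inv.
have -> : (Lambda F r r)^T = - Lambda F r r.
  by rewrite /Lambda !trmx_mul trmxK HD_tr mulNmx mulmxN mulmxA.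
rewrite -scaleN1r invmxZ ?invrN1 ?scaleN1r //.
by apply: (proj1 (mulmx1_unit (B := - invmx (Lambda F r r)) _));
   rewrite mulNmx mulmxN opprK mulmxV.
Qed.

(** Blocks of the intermediate product of [HD]^-1 with the transpose of [bidiag]. *)
Definition row_part a b : 'M[F]_r :=
  HD_inv a b - (if (b.+1 < r)%N then HD_inv a b.+1 else 0) * T^T.

Lemma block_Lambda_inv (a b : 'I_r) : block Lambda_inv a b =
  row_part a b - T * (if (a.+1 < r)%N then row_part a.+1 b else 0).
Proof.
rewrite /Lambda_inv -mulmxA (mul_bidiag_tr r HD_inv) (mul_bidiag r row_part).
by rewrite blockK.
Qed.

Lemma tr1T : (1 - T)^T = 1 - T^T.
Proof. by rewrite [LHS]linearB /=; congr (_ - _); apply: trmx1. Qed.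

Lemma mul1T_trT : (1 - T) * T^T = Err - (1 - T)^T.
Proof. by rewrite mulrBl mul1r mulT_trT tr1T !opprB addrCA. Qed.

(* Since X^(b + 2) = X^(1 - k) for b = r - k, lc k is -X^(1 - k) P E_rr. *)
Local Notation lc k := (last_col r (last_col_e F r (r - k))).

Lemma sub1T_mulX : (1 - T) - X * ((1 - T) * T^T) = - (X * Err).
Proof.
by rewrite mul1T_trT mulrBr mulX_tr1T opprB addrA -[1 - T]opprB addNr add0r.
Qed.

(** P commutes with X, so X^(b + r a) P factors out on the left and [sub1T_mulX] leaves only a last
    column. *)
Lemma row_core a b : (b <= a)%N -> (a <= b + r)%N ->
  X ^+ (b + r * a) * P * (1 - T) - X ^+ (b.+1 + r * a) * P * (1 - T) * T^T
  = lc (a - b).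
Proof.
move=> ba ab; rewrite -exprX_P_last_col ?leq_subr //.
have -> : X ^+ (r - (a - b)).+2 = X ^+ (b.+1 + r * a).
  apply: (geom0_expr_mod geom0).
  by rewrite -[LHS](modnMDl a) -[RHS]modnDr; congr (_ %% _)%N; nia.
have [_ PE] := PE F r_gt0 r_even.
have comm_P := geom0_even_comm X r; rewrite -PE in comm_P.
have := sub1T_mulX; move: comm_P.
rewrite addSn exprSr; move: (1 - T) (T^T) (X) => Y T' x comm_P key.
rewrite -[x ^+ _ * x * P]mulrA comm_P mulrA mulNr.
by rewrite -!mulrA -mulrBr -mulrBr key !mulrN.
Qed.

Lemma row_partE a b : (b <= a)%N -> (a <= b + r)%N -> (b.+1 < r)%N ->
  row_part a b = lc (a - b) + cyc_corr X r a b * (1 - T)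
                 - cyc_corr X r a b.+1 * (Err - (1 - T)^T).
Proof.
move=> ba ab b_lt; rewrite /row_part b_lt -row_core // /HD_inv /cyc_inv.
have [_ <-] := PE F r_gt0 r_even.
rewrite !mulrDl -[_ * _ * T^T in RHS]mulrA -mul1T_trT -!mulrA.
by rewrite opprD -[RHS]addrA addrACA.
Qed.

Lemma lc_step a b : (b <= a)%N -> (a < b + r)%N ->
  lc (a.+1 - b) = X ^+ r * lc (a - b).
Proof.
move=> ba ab; rewrite -!row_core ?leqW ?(ltnW ab) // [RHS]mulrBr !mulrA -!exprD.
by congr (X ^+ _ * _ * _ - X ^+ _ * _ * _ * _); lia.
Qed.

(** By [lc_step] the left side is (1 - T X^-1) applied to one column, and 1 - T X^-1 = E_rr keeps
    only its bottom entry. *)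
Lemma lc_inner a b : (b <= a)%N -> (a < b + r)%N ->
  lc (a - b) - T * lc (a.+1 - b) = last_col_e F r (r - (a - b)) r *: Err.
Proof.
move=> ba ab; rewrite lc_step // -mulErr_last_col // mulrA.
rewrite -[X in X - _]mul1r -mulrBl.
congr (_ * _); rewrite -(geom0_expr geom0) exprS -mulrBl -mulErr_X -mulrA -exprS.
by rewrite (geom0_expr geom0) mulr1.
Qed.

Lemma cyc_corr_lt a b : (b < a)%N -> cyc_corr X r a b = 0.
Proof. by move=> ba; rewrite /cyc_corr gtn_eqF // ltnNge ltnW. Qed.

Lemma cyc_corr_diag a : cyc_corr X r a a = 1.
Proof. by rewrite /cyc_corr eqxx. Qed.

Lemma cyc_corr_succ a : cyc_corr X r a a.+1 = X - 1.
Proof.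
rewrite /cyc_corr ltn_eqF // ltnSn (geom0_expr_diag geom0); congr (_ - _).
by rewrite addSn exprS (geom0_expr_diag geom0) mulr1.
Qed.

Lemma last_col_e_corner k : (k < r)%N ->
  last_col_e F r (r - k) r = (-1) ^+ k.+1.
Proof.
move=> k_lt; rewrite /last_col_e subKn ?(ltnW k_lt) //.
rewrite gtn_eqF // ltnNge ltnW //=.
have -> : odd (r - k) = odd k by lia.
rewrite -[(-1) ^+ r.+1]signr_odd -[(-1) ^+ r]signr_odd -[RHS]signr_odd /=.
by rewrite r_even (negbTE r_even); case: (odd k).
Qed.

(** X - T sends both E_rr and (1 - T)^t to -E_rr. In the diagonal blocks this lets T replace X. *)
Lemma mulXBT_Err_tr1T : (X - T) * (Err - (1 - T)^T) = 0.
Proof.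
rewrite mulrBr mulXBT_Err // mulrBl mulX_tr1T tr1T mulrBr mulr1 mulT_trT.
suff -> : T - 1 - (T - (1 - Err)) = - Err by rewrite subrr.
by rewrite opprB addrC addrA subrK addrAC subrr sub0r.
Qed.

Lemma block_far (a b : 'I_r) : (a.+1 < r)%N -> (b.+1 < a)%N ->
  block Lambda_inv a b = last_col_e F r (r - (a - b)) r *: Err.
Proof.
move=> a_lt ba; rewrite block_Lambda_inv a_lt -lc_inner; try lia.
by rewrite !row_partE ?cyc_corr_lt ?mul0r ?addr0 ?subr0 //; lia.
Qed.

(** The only surviving correction of row a is [cyc_corr X r a b.+1] = 1; its -E_rr cancels the E_rr
    from [lc_inner], and row a + 1 has no correction. *)
Lemma block_subdiag (a b : 'I_r) : (a.+1 < r)%N -> a = b.+1 :> nat ->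
  block Lambda_inv a b = 1 - T^T.
Proof.
move=> a_lt ab; rewrite block_Lambda_inv a_lt !row_partE; try lia.
rewrite ab cyc_corr_diag !cyc_corr_lt ?mul0r ?mul1r ?addr0 ?subr0; try lia.
rewrite addrAC lc_inner; try lia.
rewrite subSnn last_col_e_corner; last by lia.
by rewrite expr2 mulrNN mulr1 scale1r subKr tr1T.
Qed.

Lemma block_diag (a : 'I_r) : (a.+1 < r)%N ->
  block Lambda_inv a a = T^T - T.
Proof.
move=> a_lt; rewrite block_Lambda_inv a_lt !row_partE; try lia.
rewrite !cyc_corr_diag cyc_corr_succ cyc_corr_lt // mul0r !mul1r addr0.
have a_ar : (a < a + r)%N by lia.
have /eqP := lc_inner (leqnn a) a_ar.
rewrite last_col_e_corner ?subnn ?expr1 ?scaleN1r //.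
rewrite subr_eq => /eqP ->.
have /eqP := mulXBT_Err_tr1T; rewrite mulrBl subr_eq0 => /eqP XT.
rewrite mulrBl XT mul1r [T * (_ - (Err - _))]mulrBr tr1T.
move: (T * lc _) => A; move: (T * (Err - _)) => B; move: (T^T) => T'.
move: T Err => T0 E0.
by apply/matrixP => i j; rewrite !mxE; ring.
Qed.

(** No block row lies below the last one, so nothing reduces the column to its bottom entry. *)
Lemma block_last_far (a b : 'I_r) : a.+1 = r -> (b.+1 < a)%N ->
  block Lambda_inv a b = last_col r (last_col_e F r b.+1).
Proof.
move=> ar ba; rewrite block_Lambda_inv ar ltnn mulr0 subr0 row_partE; try lia.
rewrite !cyc_corr_lt ?mul0r ?addr0 ?subr0; try lia.
by congr (last_col _ (last_col_e _ _ _)); lia.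
Qed.

Lemma block_last_subdiag (a b : 'I_r) : a.+1 = r -> a = b.+1 :> nat ->
  block Lambda_inv a b = (1 - T^T) + last_col r (last_col_f F r).
Proof.
move=> ar ab; rewrite block_Lambda_inv ar ltnn mulr0 subr0 row_partE; try lia.
rewrite ab cyc_corr_diag cyc_corr_lt ?mul0r ?mul1r ?addr0 //.
rewrite tr1T opprB addrCA; congr (_ + _).
apply/matrixP => i j; rewrite !mxE.
(* The column has odd parameter r - 1: it is 0 at i = 1 and (-1)^i beyond. Its bottom entry (-1)^r =
   1 is removed by -E_rr. *)
have -> : (b.+1 - b)%N = 1%N by lia.
rewrite /last_col_e /last_col_f subKn //.
have -> : odd (r - 1) by lia.
rewrite andbC; case: (j.+1 == r) => /=; last by rewrite subrr.
case: (i.+1 =P 1%N) => [->|i1] /=.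
  by rewrite ltn_eqF ?subrr //; lia.
case: eqP => [->|_]; last by rewrite subr0.
by rewrite -signr_odd (negbTE r_even) subrr.
Qed.

Lemma block_last_diag (a : 'I_r) : a.+1 = r ->
  block Lambda_inv a a = (P + 1) * (1 - T).
Proof.
move=> ar; rewrite block_Lambda_inv ar ltnn mulr0 subr0 /row_part ar ltnn.
rewrite mul0r subr0 /HD_inv /cyc_inv cyc_corr_diag (geom0_expr_diag geom0) mul1r.
by rewrite (proj2 (PE F r_gt0 r_even)).
Qed.

End Inverse.

Theorem mainTheorem8 (F : numFieldType) (n r : nat)
    (r_gt0 : (0 < r)%N) (n_eq_r : n = r) (r_even : ~~ odd r) :
  Lambda F n r \in unitmx /\
  let L : 'I_n -> 'I_n -> 'M[F]_r := block (invmx (Lambda F n r)) in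
  let T := T F r in
  (* (a) *)
  (forall a : 'I_n, (a.+1 <= n - 1)%N -> L a a = T^T - T) /\
  (* (b) *)
  (X F r - X F r ^+ n \in unitmx /\
   forall a : 'I_n, a.+1 = n -> L a a = (P F n r + 1%:M) *m (1%:M - T)) /\
  (* (c) *)
  (forall a b : 'I_n, (2 <= a.+1 <= n - 1)%N -> b.+1 = (a.+1 - 1)%N ->
     L a b = 1%:M - T^T) /\
  (* (d) *)
  (forall a b : 'I_n, (a.+1 < n)%N -> (b.+1 + 1 < a.+1)%N ->
     L a b = if ~~ odd (a.+1 - b.+1) then - E F r r r else E F r r r) /\
  (* (e) *)
  (forall a b : 'I_n, a.+1 = n -> (b.+1 < n - 1)%N ->
     L a b = last_col r (last_col_e F r b.+1)) /\
  (* (f) *)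
  (forall a b : 'I_n, a.+1 = n -> b.+1 = (n - 1)%N ->
     L a b = (1%:M - T^T) + last_col r (last_col_f F r)) /\
  (* (g) *)
  (forall a b : 'I_n, (a.+1 < b.+1)%N -> L a b = - (L b a)^T).
Proof.
subst n; have [uL LV] := Lambda_invP F r_gt0 r_even.
split=> // L T.
have blockL a b : L a b = block (Lambda_inv F r) a b by rewrite /L LV.
split; [|split; [|split; [|split; [|split; [|split]]]]].
- by move=> a a_lt; rewrite blockL block_diag //; lia.
- split; first exact: (proj1 (PE F r_gt0 r_even)).
  by move=> a ar; rewrite blockL block_last_diag.
- by move=> a b a_lt ab; rewrite blockL block_subdiag //; lia.
- move=> a b a_lt ba; rewrite blockL block_far //; last by lia.
  rewrite last_col_e_corner //; last by have := ltn_ord a; lia.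
  by rewrite subSS -signr_odd /=; case: odd; rewrite ?scale1r ?scaleN1r.
- by move=> a b ar br; rewrite blockL block_last_far //; lia.
- by move=> a b ar br; rewrite blockL block_last_subdiag //; lia.
(* Part (g) is the skew-symmetry of the inverse read blockwise. *)
by move=> a b ab; rewrite !blockL -tr_block Lambda_inv_tr // blockN opprK.
Qed.
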